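(* Assume that the fan and reference profiles agree on $P_-$ and on $P_+$ (i.e. for $\xi<\nu_0$ and for $\xi>\nu_N$). Then $$\mathfrak E=\sum_{i=1}^N\sum_{j=1}^M\omega_{ij}\left(H_i-H_j^{\mathrm{ref}}\right),\qquad \mathfrak D=\sum_{i=1}^N\sum_{j=1}^M\omega_{ij}\left(\Lambda_j^{\mathrm{ref}}-\Lambda_i\right),$$ where $\omega_{ij}:=\left[\min\{\nu_i,\sigma_j\}-\max\{\nu_{i-1},\sigma_{j-1}\}\right]_+$ and $[z]_+:=\max\{z,0\}$.
   Context: $e:(0,\infty)\to\mathbb R$ is the specific internal energy of a pressure law ($p(\rho)=\rho^2e'(\rho)$, $p'>0$). The statement concerns an admissible piecewise constant fan subsolution of the isentropic Euler equations and a piecewise constant self-similar reference solution with the same Riemann data $(\rho_\pm,v_\pm)$; only the following data enter. Fan: speeds $\nu_0<\nu_1<\dots<\nu_N$, densities $\rho_i>0$ and kinetic levels $C_i>0$ ($i=1,\dots,N$). Set $H_i=\tfrac12\rho_iC_i+\rho_ie(\rho_i)$, $\Lambda_i=\tfrac12\rho_iC_i-\rho_ie(\rho_i)$, and for the exterior states $H_\pm=\tfrac12\rho_\pm|v_\pm|^2+\rho_\pm e(\rho_\pm)$, $\Lambda_\pm=\tfrac12\rho_\pm|v_\pm|^2-\rho_\pm e(\rho_\pm)$. In the similarity variable $\xi=x_2/t$, $H^{\mathrm{fan}}(\xi)$ equals $H_-$ for $\xi<\nu_0$ (region $P_-$), $H_i$ for $\nu_{i-1}<\xi<\nu_i$,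 and $H_+$ for $\xi>\nu_N$ (region $P_+$); $\Lambda^{\mathrm{fan}}$ is defined likewise with $\Lambda_-,\Lambda_i,\Lambda_+$. Reference: a partition $-\infty=\sigma_0<\sigma_1<\dots<\sigma_M=\infty$ and constants $\rho_j^{\mathrm{ref}}>0$, $v_j^{\mathrm{ref}}\in\mathbb R^2$; $H_j^{\mathrm{ref}}=\tfrac12\rho_j^{\mathrm{ref}}|v_j^{\mathrm{ref}}|^2+\rho_j^{\mathrm{ref}}e(\rho_j^{\mathrm{ref}})$, $\Lambda_j^{\mathrm{ref}}=\tfrac12\rho_j^{\mathrm{ref}}|v_j^{\mathrm{ref}}|^2-\rho_j^{\mathrm{ref}}e(\rho_j^{\mathrm{ref}})$; $H^{\mathrm{ref}}(\xi)=H_j^{\mathrm{ref}}$ and $\Lambda^{\mathrm{ref}}(\xi)=\Lambda_j^{\mathrm{ref}}$ for $\sigma_{j-1}<\xi<\sigma_j$. Rate coefficients: $\mathfrak E=\int_{\mathbb R}[H^{\mathrm{fan}}(\xi)-H^{\mathrm{ref}}(\xi)]\,d\xi$ and $\mathfrak D=\int_{\mathbb R}[\Lambda^{\mathrm{ref}}(\xi)-\Lambda^{\mathrm{fan}}(\xi)]\,d\xi$. *)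

(* Defs.v *)
From HB Require Import structures.
From mathcomp Require Import all_boot all_order all_algebra.
From mathcomp Require Import all_classical all_reals all_analysis.
Import Order.TTheory GRing.Theory Num.Theory.
Import numFieldNormedType.Exports.
Set Implicit Arguments.
Unset Strict Implicit.
Unset Printing Implicit Defensive.
Local Open Scope classical_set_scope.
Local Open Scope ring_scope.

(* Breakpoints are families indexed by 'I_n.+1 (from 0 to n) and cells are
   indexed by 'I_n: the ordinal k stands for the (k+1)-st cell, which lies
   between the breakpoints k and k+1. *)
Definition left_end n (k : 'I_n) : 'I_n.+1 := widen_ord (leqnSn n) k.
Definition right_end n (k : 'I_n) : 'I_n.+1 := lift ord0 k.

Section Definitions.
Variable R : realType.
Implicit Types (e : R -> R) (rho q xi : R).

(* [e] is a total function of which only the values on (0, +oo) matter. *)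
Definition pressure e rho : R := rho ^+ 2 * derive1 e rho.

Definition is_internal_energy e : Prop :=
  forall rho, 0 < rho ->
    [/\ derivable e rho 1, derivable (pressure e) rho 1 &
        0 < derive1 (pressure e) rho].

(* The Euclidean norm squared; the library norm on row vectors is the sup
   norm. *)
Definition sqnorm2 (v : 'rV[R]_2) : R := \sum_(k < 2) v ord0 k ^+ 2.

(* [q] is either |v|^2 (exterior and reference states) or the kinetic level
   C_i (fan states). *)
Definition Hval e rho q : R := 2^-1 * rho * q + rho * e rho.
Definition Lval e rho q : R := 2^-1 * rho * q - rho * e rho.

(* Piecewise constant function: at most one term of the sum is selected when
   [s] is increasing. The value at the breakpoints, a null set, is
   conventionally 0. *)
Definition cellwise n (s : 'I_n.+1 -> \bar R) (a : 'I_n -> R) xi : R :=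
  \sum_(k < n | (s (left_end k) < xi%:E)%E && (xi%:E < s (right_end k))%E) a k.

Definition fan_profile n (nu : 'I_n.+1 -> R) (aminus aplus : R)
    (a : 'I_n -> R) xi : R :=
  if xi < nu ord0 then aminus
  else if nu ord_max < xi then aplus
  else cellwise (fun k => (nu k)%:E) a xi.

(* Profiles are only compared where the reference profile is prescribed, i.e.
   off its breakpoints. *)
Definition agree_outside n m (nu : 'I_n.+1 -> R) (sigma : 'I_m.+1 -> \bar R)
    (f g : R -> R) : Prop :=
  forall xi, (forall j, sigma j <> xi%:E) ->
    xi < nu ord0 \/ nu ord_max < xi -> f xi = g xi.

(* Extended-real valued on purpose: an equality with a real number then also
   asserts that the integral is finite. *)
Definition rate (f g : R -> R) : \bar R :=
  (\int[lebesgue_measure]_(xi in [set: R]) (f xi - g xi)%:E)%E.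

(* For increasing breakpoints both the minimum and the maximum are finite, so
   that [fine] loses nothing. *)
Definition overlap n m (nu : 'I_n.+1 -> R) (sigma : 'I_m.+1 -> \bar R)
    (i : 'I_n) (j : 'I_m) : R :=
  Num.max (fine (Order.min (nu (right_end i))%:E (sigma (right_end j)))
           - fine (Order.max (nu (left_end i))%:E (sigma (left_end j)))) 0.

End Definitions.

(* Main.v *)
Require Import Defs.
From HB Require Import structures.
From mathcomp Require Import all_boot all_order all_algebra.
From mathcomp Require Import all_classical all_reals all_analysis.
From mathcomp Require Import measurable_realfun.
Import Order.TTheory GRing.Theory Num.Theory.
Import numFieldNormedType.Exports.
Local Open Scope classical_set_scope.
Local Open Scope ring_scope.

(** Off the finitely many breakpoints, which form a null set, each point between
    the extreme fan speeds lies in exactly one fan cell and exactly one reference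
    cell, and elsewhere the two profiles agree. So almost everywhere the
    difference of the profiles is the sum, over pairs of a fan cell and a
    reference cell, of the difference of their constants times the indicator of
    the intersection of the two cells ([fan_sub_ref]). That each point lies in
    one cell is a telescoping sum ([sum_in_cell]). A fan cell is bounded, so the
    intersection is a bounded, possibly empty, open interval, whose length is the
    weight of the pair ([in_overlap_itv], [lebesgue_measure_overlap_itv]).
    Integrating the finite sum of indicators gives both identities, since the
    second difference of profiles is the opposite of one of the same form
    ([rate_eq_overlap]). *)

(** * Cells of a partition of the line *)

Definition in_cell {R : realType} {n} (s : 'I_n.+1 -> \bar R) (k : 'I_n)
    (xi : R) : bool :=
  (s (left_end k) < xi%:E)%E && (xi%:E < s (right_end k))%E.

Lemma cellwiseE {R : realType} n (s : 'I_n.+1 -> \bar R) (a : 'I_n -> R) xi :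
  cellwise s a xi = \sum_(k < n) (in_cell s k xi)%:R * a k.
Proof.
rewrite /cellwise big_mkcond /=; apply: eq_bigr => k _.
by rewrite /in_cell; case: ifP => _; rewrite ?mul1r ?mul0r.
Qed.

Lemma telescope_ends {V : zmodType} n (u : 'I_n.+1 -> V) :
  \sum_(k < n) (u (left_end k) - u (right_end k)) = u ord0 - u ord_max.
Proof.
rewrite sumrB; apply/eqP; rewrite subr_eq addrAC eq_sym subr_eq; apply/eqP.
by rewrite -big_ord_recl big_ord_recr.
Qed.

Lemma incr_nondecreasing {d} {T : porderType d} {n} (s : 'I_n.+1 -> T) :
  (forall k l : 'I_n.+1, (k < l)%N -> (s k < s l)%O) ->
  forall k l : 'I_n.+1, (k <= l)%N -> (s k <= s l)%O.
Proof.
move=> s_incr k l; rewrite leq_eqVlt => /orP[/eqP/val_inj -> //|kl].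
exact/ltW/s_incr.
Qed.

(** Off the breakpoints, lying in the cell k means lying beyond its left end but
    not beyond its right end, so the number of cells that contain xi
    telescopes. *)
Lemma sum_in_cell {R : realType} n (s : 'I_n.+1 -> \bar R) xi :
  (forall k l : 'I_n.+1, (k < l)%N -> (s k < s l)%E) ->
  (forall k, s k <> xi%:E) ->
  \sum_(k < n) (in_cell s k xi)%:R =
    (s ord0 < xi%:E)%E%:R - (s ord_max < xi%:E)%E%:R :> R.
Proof.
move=> s_incr s_neq; rewrite -(telescope_ends _ (fun k => (s k < xi%:E)%E%:R)).
apply: eq_bigr => k _; rewrite /in_cell.
have lt_lr : (s (left_end k) < s (right_end k))%E by apply: s_incr.
have [lt_r|gt_r|eq_r] := ltgtP (s (right_end k)) xi%:E.
- by rewrite (lt_trans lt_lr lt_r) subrr.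
- by rewrite andbT subr0.
- by have := s_neq (right_end k).
Qed.

Lemma sum_in_cell1 {R : realType} n (s : 'I_n.+1 -> \bar R) xi :
  (forall k l : 'I_n.+1, (k < l)%N -> (s k < s l)%E) ->
  (forall k, s k <> xi%:E) ->
  (s ord0 < xi%:E)%E -> (xi%:E < s ord_max)%E ->
  \sum_(k < n) (in_cell s k xi)%:R = 1 :> R.
Proof.
move=> s_incr s_neq lt0 ltM; rewrite sum_in_cell // lt0 /=.
by rewrite ltNge (ltW ltM) subr0.
Qed.

(** * Difference of the two profiles off the breakpoints *)

(** With total weights 1, each single sum can be spread over the other index. *)
Lemma sub_weighted_sums {R : comPzRingType} {I J : finType}
    (p a : I -> R) (q b : J -> R) :
  \sum_i p i = 1 -> \sum_j q j = 1 ->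
  \sum_i p i * a i - \sum_j q j * b j =
    \sum_i \sum_j p i * q j * (a i - b j).
Proof.
move=> p1 q1.
have -> : \sum_i p i * a i = \sum_i \sum_j p i * q j * a i.
  apply: eq_bigr => i _; rewrite -mulr_suml -mulr_sumr.
  by rewrite q1 mulr1.
have -> : \sum_j q j * b j = \sum_i \sum_j p i * q j * b j.
  rewrite exchange_big; apply: eq_bigr => j _ /=.
  by rewrite -!mulr_suml p1 mul1r.
rewrite -sumrB; apply: eq_bigr => i _; rewrite -sumrB.
by apply: eq_bigr => j _; rewrite mulrBr.
Qed.

(** Outside the fan both sides vanish, the left one by agreement and the right
    one because no fan cell contains xi; inside, xi lies in exactly one fan cell
    and in exactly one reference cell. *)
Lemma fan_sub_ref {R : realType} n m (nu : 'I_n.+1 -> R)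
    (sigma : 'I_m.+1 -> \bar R) (am ap : R) (a : 'I_n -> R) (b : 'I_m -> R) xi :
  (forall k l : 'I_n.+1, (k < l)%N -> nu k < nu l) ->
  sigma ord0 = -oo%E -> sigma ord_max = +oo%E ->
  (forall k l : 'I_m.+1, (k < l)%N -> (sigma k < sigma l)%E) ->
  agree_outside nu sigma (fan_profile nu am ap a) (cellwise sigma b) ->
  (forall k, nu k <> xi) -> (forall k, sigma k <> xi%:E) ->
  fan_profile nu am ap a xi - cellwise sigma b xi =
    \sum_i \sum_j (in_cell (fun k => (nu k)%:E) i xi)%:R *
      (in_cell sigma j xi)%:R * (a i - b j).
Proof.
move=> nu_incr sigma0 sigmaM sigma_incr agree nu_neq sigma_neq.
have nu_le := incr_nondecreasing _ nu_incr.
have outside : xi < nu ord0 \/ nu ord_max < xi ->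
    forall i, in_cell (fun k => (nu k)%:E) i xi = false.
  move=> out i; apply/negP; rewrite /in_cell !lte_fin => /andP[lt_l lt_r].
  case: out => [lt0|ltM].
    have := lt_le_trans lt0 (nu_le ord0 (left_end i) (leq0n _)).
    by rewrite ltNge (ltW lt_l).
  have := lt_le_trans lt_r (nu_le (right_end i) ord_max (leq_ord _)).
  by rewrite ltNge (ltW ltM).
have [out|nout] := EM (xi < nu ord0 \/ nu ord_max < xi).
  rewrite (agree _ sigma_neq out) subrr big1// => i _.
  by rewrite big1// => j _; rewrite outside// !mul0r.
have gt0 : nu ord0 < xi.
  rewrite lt_neqAle leNgt; apply/andP; split; first exact/eqP/nu_neq.
  by apply/negP => lt; apply: nout; left.
have ltM : xi < nu ord_max.
  rewrite lt_neqAle leNgt eq_sym; apply/andP; split; first exact/eqP/nu_neq.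
  by apply/negP => lt; apply: nout; right.
rewrite /fan_profile ltNge (ltW gt0) /= ltNge (ltW ltM) /= !cellwiseE.
apply: sub_weighted_sums; apply: sum_in_cell1 => //.
- by move=> k [] /nu_neq.
- by rewrite sigma0 ltNyr.
- by rewrite sigmaM ltry.
Qed.

(** * Integration *)

Lemma measurable_cellwise {R : realType} n (s : 'I_n.+1 -> \bar R)
    (a : 'I_n -> R) : measurable_fun [set: R] (cellwise s a).
Proof.
rewrite (_ : cellwise s a = fun xi =>
    \sum_k if in_cell s k xi then a k else 0); last first.
  by apply/funext => xi; rewrite /cellwise big_mkcond.
apply: measurable_sum => k; apply: measurable_fun_ifT => //.
by apply: measurable_and; apply: measurable_fun_lte.
Qed.

Lemma measurable_fan_profile {R : realType} n (nu : 'I_n.+1 -> R) (am ap : R)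
    (a : 'I_n -> R) : measurable_fun [set: R] (fan_profile nu am ap a).
Proof.
apply: measurable_fun_ifT => //; first exact: measurable_fun_ltr.
apply: measurable_fun_ifT => //; first exact: measurable_fun_ltr.
exact: measurable_cellwise.
Qed.

(** A bounded cell meets any cell in a bounded interval, whose length is the
    overlap. *)
Definition overlap_itv {R : realType} {n m} (nu : 'I_n.+1 -> R)
    (sigma : 'I_m.+1 -> \bar R) (i : 'I_n) (j : 'I_m) : interval R :=
  `]fine (Order.max (nu (left_end i))%:E (sigma (left_end j))),
    fine (Order.min (nu (right_end i))%:E (sigma (right_end j)))[.

Lemma lebesgue_measure_overlap_itv {R : realType} n m (nu : 'I_n.+1 -> R)
    (sigma : 'I_m.+1 -> \bar R) i j :
  lebesgue_measure [set` overlap_itv nu sigma i j] =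
    (overlap nu sigma i j)%:E.
Proof.
rewrite lebesgue_measure_itv /= /overlap lte_fin -subr_gt0.
by case: ltP => h; rewrite ?EFinB.
Qed.

(** The left end of a reference cell is below +oo and its right end above -oo, so
    the maximum and the minimum with fan speeds are finite and taking their real
    parts preserves the order relations with xi. *)
Lemma in_overlap_itv {R : realType} n m (nu : 'I_n.+1 -> R)
    (sigma : 'I_m.+1 -> \bar R) i j xi :
  sigma ord0 = -oo%E -> sigma ord_max = +oo%E ->
  (forall k l : 'I_m.+1, (k < l)%N -> (sigma k < sigma l)%E) ->
  (xi \in overlap_itv nu sigma i j) =
    in_cell (fun k => (nu k)%:E) i xi && in_cell sigma j xi.
Proof.
move=> sigma0 sigmaM sigma_incr.
have lt_l : (sigma (left_end j) < +oo)%E.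
  by rewrite -sigmaM; apply: sigma_incr => /=.
have gt_r : (-oo < sigma (right_end j))%E.
  by rewrite -sigma0; apply: sigma_incr.
rewrite /overlap_itv in_itv /= -!lte_fin !fineK; last 2 first.
- by rewrite fin_numE gt_eqF ?lt_eqF// ?lt_min ?ltNyr// gt_min ltry.
- by rewrite fin_numE gt_eqF ?lt_eqF// ?gt_max ?ltry// lt_max ltNyr.
by rewrite gt_max lt_min /in_cell andbACA.
Qed.

Lemma integral_sum_overlap {R : realType} n m (nu : 'I_n.+1 -> R)
    (sigma : 'I_m.+1 -> \bar R) (c : 'I_n -> 'I_m -> R) :
  (\int[lebesgue_measure]_(xi in [set: R])
     (\sum_i \sum_j (c i j)%:E *
        (\1_[set` overlap_itv nu sigma i j] xi)%:E))%E =
  (\sum_i \sum_j overlap nu sigma i j * c i j)%:E.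
Proof.
have int_ij i j : lebesgue_measure.-integrable [set: R]
    (fun xi => (\1_[set` overlap_itv nu sigma i j] xi)%:E).
  exact: integrable_indic_itv.
have cint_ij i j : lebesgue_measure.-integrable [set: R]
    (fun xi => (c i j)%:E * (\1_[set` overlap_itv nu sigma i j] xi)%:E)%E.
  exact: integrableZl.
rewrite integral_sum //; last by move=> i; apply: integrable_sum.
rewrite -sumEFin; apply: eq_bigr => i _.
rewrite integral_sum// -sumEFin; apply: eq_bigr => j _.
rewrite integralZl// integral_indic// setIT.
rewrite mulrC EFinM; congr (_ * _)%E.
exact: lebesgue_measure_overlap_itv.
Qed.

(** Breakpoints form a finite, hence null, set, so only the values off them
    matter for the integral. *)
Lemma rate_eq_overlap {R : realType} n m (nu : 'I_n.+1 -> R)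
    (sigma : 'I_m.+1 -> \bar R) (c : 'I_n -> 'I_m -> R) (f g : R -> R) :
  sigma ord0 = -oo%E -> sigma ord_max = +oo%E ->
  (forall k l : 'I_m.+1, (k < l)%N -> (sigma k < sigma l)%E) ->
  measurable_fun [set: R] f -> measurable_fun [set: R] g ->
  (forall xi, (forall k, nu k <> xi) -> (forall k, sigma k <> xi%:E) ->
    f xi - g xi = \sum_i \sum_j (in_cell (fun k => (nu k)%:E) i xi)%:R *
      (in_cell sigma j xi)%:R * c i j) ->
  rate f g = (\sum_i \sum_j overlap nu sigma i j * c i j)%:E.
Proof.
move=> sigma0 sigmaM sigma_incr mf mg fgE.
rewrite -integral_sum_overlap /rate; apply: ae_eq_integral => //.
- exact/measurable_EFinP/measurable_funB.
- apply: emeasurable_sum => i; apply: emeasurable_sum => j.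
  apply/measurable_EFinP/measurable_funM => //.
have null : lebesgue_measure.-negligible (range nu `|` range (fine \o sigma)).
  have fin : finite_set (range nu `|` range (fine \o sigma)).
    by rewrite finite_setU; split; apply: finite_image.
  have cnt := finite_set_countable fin.
  apply/negligibleP; last exact: countable_lebesgue_measure0.
  exact: countable_measurable.
apply: negligibleS null => xi /= neq; apply: contrapT => not_brk.
apply: neq => _; rewrite fgE; last 2 first.
- by move=> k nuk; apply: not_brk; left; exists k.
- by move=> k sigmak; apply: not_brk; right; exists k; rewrite //= sigmak.
rewrite -sumEFin; apply: eq_bigr => i _.
rewrite -sumEFin; apply: eq_bigr => j _.
by rewrite indicE mem_setE in_overlap_itv// -EFinM mulrC -mulnb natrM.
Qed.

Theorem proposition3p3 (R : realType) (e : R -> R)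
  (he : is_internal_energy e)
  (rhom rhop : R) (vm vp : 'rV[R]_2)
  (hrhom : 0 < rhom) (hrhop : 0 < rhop)
  (N : nat) (nu : 'I_N.+1 -> R) (rho C : 'I_N -> R)
  (hnu : forall k l : 'I_N.+1, (k < l)%N -> nu k < nu l)
  (hrho : forall i, 0 < rho i) (hC : forall i, 0 < C i)
  (M : nat) (sigma : 'I_M.+1 -> \bar R)
  (rhoref : 'I_M -> R) (vref : 'I_M -> 'rV[R]_2)
  (hsigma0 : sigma ord0 = -oo%E) (hsigmaM : sigma ord_max = +oo%E)
  (hsigma : forall k l : 'I_M.+1, (k < l)%N -> (sigma k < sigma l)%E)
  (hrhoref : forall j, 0 < rhoref j) :
  let H := fun i => Hval e (rho i) (C i) in
  let L := fun i => Lval e (rho i) (C i) in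
  let Href := fun j => Hval e (rhoref j) (sqnorm2 (vref j)) in
  let Lref := fun j => Lval e (rhoref j) (sqnorm2 (vref j)) in
  let Hfan_profile := fan_profile nu
    (Hval e rhom (sqnorm2 vm)) (Hval e rhop (sqnorm2 vp)) H in
  let Lfan_profile := fan_profile nu
    (Lval e rhom (sqnorm2 vm)) (Lval e rhop (sqnorm2 vp)) L in
  let Href_profile := cellwise sigma Href in
  let Lref_profile := cellwise sigma Lref in
  agree_outside nu sigma Hfan_profile Href_profile ->
  agree_outside nu sigma Lfan_profile Lref_profile ->
  rate Hfan_profile Href_profile =
    (\sum_(i < N) \sum_(j < M) overlap nu sigma i j * (H i - Href j))%:E /\
  rate Lref_profile Lfan_profile =
    (\sum_(i < N) \sum_(j < M) overlap nu sigma i j * (Lref j - L i))%:E.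
Proof.
move=> H L Href Lref HF LF HR LR agreeH agreeL.
split; apply: rate_eq_overlap => //; try exact: measurable_fan_profile;
  try exact: measurable_cellwise; move=> xi nu_neq sigma_neq.
  exact: fan_sub_ref.
rewrite -opprB fan_sub_ref// -sumrN; apply: eq_bigr => i _.
by rewrite -sumrN; apply: eq_bigr => j _; rewrite -mulrN opprB.
Qed.
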